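(* Let $d\ge 1$. For every $n\ge 1$ and every sample $X_1,\dots,X_n\in[0,1]^d$, $$\bar\omega^2_d=\frac{1}{n^2}\sum_{i,j=1}^n \mathrm{pairFactorAvg}(X_i,X_j)-\frac{2}{n}\sum_{i=1}^n \mathrm{crossFactorAvg}(X_i)+\left(\frac13\right)^d,$$ where $\mathrm{pairFactorAvg}(a,b)=\frac{1}{2^d}\sum_c\mathrm{pairFactor}_c(a,b)$ and $\mathrm{crossFactorAvg}(a)=\frac{1}{2^d}\sum_c\mathrm{crossFactor}_c(a)$, the sums running over all $2^d$ corners $c$ of $[0,1]^d$.
   Context: A corner of $[0,1]^d$ is a function $c:\{0,\dots,d-1\}\to\{\mathrm{true},\mathrm{false}\}$; there are $2^d$ corners. For a corner $c$ and $x\in[0,1]^d$, let $\mathrm{cornerLe}(c,x)=\{s\in[0,1]^d:\ \text{for all }k,\ s_k\ge x_k\text{ if }c(k)=\mathrm{true},\ s_k\le x_k\text{ if }c(k)=\mathrm{false}\}$. For a (deterministic) sample $X_1,\dots,X_n\in[0,1]^d$ put $F_n^c(x)=\frac1n\sum_{i=1}^n\mathbf 1\{X_i\in\mathrm{cornerLe}(c,x)\}$, and put $F^c(x)=\prod_{k=0}^{d-1}g_k(x)$ with $g_k(x)=1-x_k$ if $c(k)=\mathrm{true}$ and $g_k(x)=x_k$ if $c(k)=\mathrm{false}$. Define $\omega^2_c=\int_{[0,1]^d}(F_n^c(x)-F^c(x))^2\,dx$ and $\bar\omega^2_d=\frac1{2^d}\sum_c\omega^2_c$ (sum over all corners). For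 $t\in[0,1]$ let $\mathrm{reflect}_{c,k}(t)=1-t$ if $c(k)=\mathrm{true}$ and $=t$ otherwise. For $a,b\in[0,1]^d$ define $\mathrm{pairFactor}_c(a,b)=\prod_{k=0}^{d-1}\bigl(1-\max(\mathrm{reflect}_{c,k}(a_k),\mathrm{reflect}_{c,k}(b_k))\bigr)$ and $\mathrm{crossFactor}_c(a)=\prod_{k=0}^{d-1}\frac{1-\mathrm{reflect}_{c,k}(a_k)^2}{2}$. *)

(* Defs.v *)
From HB Require Import structures.
From mathcomp Require Import all_boot all_order all_algebra.
From mathcomp Require Import all_classical all_reals all_analysis.

Set Implicit Arguments.
Unset Strict Implicit.
Unset Printing Implicit Defensive.

Import Order.TTheory GRing.Theory Num.Theory.
Import numFieldNormedType.Exports.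

Local Open Scope classical_set_scope.
Local Open Scope ring_scope.

(* Points of R^d are d-tuples: the library equips [d.-tuple T] with the product
   sigma-algebra but provides no Lebesgue measure on it, so that measure is
   built here as an iterated product, transported along
   R * R^d ~ R^(d+1); [lebesgue_tuple_box] checks its value on boxes. *)
Section lebesgue_tuple.
Context {R : realType}.

Local Notation RR := (measurableTypeR R).

Definition tcons (d : nat) (p : RR * d.-tuple RR) : d.+1.-tuple RR :=
  [tuple of p.1 :: p.2].

Definition tuncons (d : nat) (t : d.+1.-tuple RR) : RR * d.-tuple RR :=
  (thead t, [tuple of behead t]).

Lemma tconsK d : cancel (@tcons d) (@tuncons d).
Proof. by case=> x t; congr pair; apply/val_inj. Qed.

Lemma measurable_tcons d : measurable_fun [set: RR * d.-tuple RR] (@tcons d).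
Proof. exact: measurable_cons. Qed.

Lemma measurable_tuncons d :
  measurable_fun [set: d.+1.-tuple RR] (@tuncons d).
Proof.
apply: measurable_fun_pair; last exact: measurable_behead.
exact: (measurable_tnth ord0).
Qed.

Section step.
Context (d : nat) (mu : {sigma_finite_measure set (d.-tuple RR) -> \bar R}).

Definition lebesgue_step : set (d.+1.-tuple RR) -> \bar R :=
  pushforward (@lebesgue_measure R \x mu)%E (@tcons d).

Let lebesgue_step0 : lebesgue_step set0 = 0%E.
Proof. by rewrite /lebesgue_step /pushforward preimage_set0 measure0. Qed.

Let lebesgue_step_ge0 A : (0 <= lebesgue_step A)%E.
Proof. by rewrite /lebesgue_step /pushforward; exact: measure_ge0. Qed.

Let lebesgue_step_sigma_additive : semi_sigma_additive lebesgue_step.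
Proof.
have mT A : measurable A -> measurable (@tcons d @^-1` A).
  by move=> mA; rewrite -[X in measurable X]setTI; exact: measurable_tcons.
move=> F mF tF mUF; rewrite /lebesgue_step /pushforward preimage_bigcup.
apply: measure_semi_sigma_additive.
- by move=> n; exact: mT.
- apply/trivIsetP => /= i j _ _ ij; rewrite -preimage_setI.
  by move/trivIsetP : tF => /(_ _ _ _ _ ij) ->//; rewrite preimage_set0.
- by rewrite -preimage_bigcup; exact: mT.
Qed.

HB.instance Definition _ := isMeasure.Build _ _ _ lebesgue_step
  lebesgue_step0 lebesgue_step_ge0 lebesgue_step_sigma_additive.

Let lebesgue_step_sigma_finite : sigma_finite setT lebesgue_step.
Proof.
have /sigma_finiteP[F [TF ndF Foo]] := sigma_finiteT (@lebesgue_measure R).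
have /sigma_finiteP[G [TG ndG Goo]] := sigma_finiteT mu.
exists (fun n => @tuncons d @^-1` (F n `*` G n)).
  apply/esym; rewrite -preimage_bigcup -subTset => t _ /=.
  have [i _ Fi] : (\bigcup_i F i) (tuncons t).1 by rewrite -TF.
  have [j _ Gj] : (\bigcup_i G i) (tuncons t).2 by rewrite -TG.
  exists (maxn i j) => //; split.
  - by move: Fi; exact/subsetPset/ndF/leq_maxl.
  - by move: Gj; exact/subsetPset/ndG/leq_maxr.
move=> n; have [mF ?] := Foo n; have [mG ?] := Goo n; split.
  rewrite -[X in measurable X]setTI.
  by apply: measurable_tuncons => //; exact: measurableX.
rewrite /lebesgue_step /pushforward -comp_preimage.
rewrite (_ : _ \o _ = id); last by apply/funext => p /=; rewrite tconsK.
by rewrite preimage_id product_measure1E// lte_mul_pinfty// ge0_fin_numE.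
Qed.

HB.instance Definition _ := Measure_isSigmaFinite.Build _ _ _ lebesgue_step
  lebesgue_step_sigma_finite.

End step.

Fixpoint lebesgue_tuple (d : nat) :
    {sigma_finite_measure set (d.-tuple RR) -> \bar R} :=
  match d with
  | 0 => dirac ([tuple] : 0.-tuple RR)
  | d'.+1 => lebesgue_step (lebesgue_tuple d')
  end.

Lemma lebesgue_tuple_box (d : nat) (a b : d.-tuple R) :
  (forall k, tnth a k <= tnth b k) ->
  lebesgue_tuple d
    [set x | forall k, tnth a k <= tnth x k <= tnth b k] =
  (\prod_(k < d) (tnth b k - tnth a k))%:E.
Proof.
elim: d a b => [|d IH] a b ab /=.
  rewrite big_ord0 diracE mem_set//.
  by move=> [].
rewrite /lebesgue_step /pushforward.
pose a' := [tuple of behead a]; pose b' := [tuple of behead b].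
have tb (t : d.+1.-tuple R) k : tnth [tuple of behead t] k = tnth t (lift ord0 k).
  by rewrite [in RHS](tuple_eta t) tnthS.
rewrite (_ : _ @^-1` _ = `[tnth a ord0, tnth b ord0] `*`
    [set x | forall k, tnth a' k <= tnth x k <= tnth b' k]); last first.
  apply/seteqP; split => -[x t] /=.
    move=> H; split; first by rewrite in_itv/=; exact: (H ord0).
    by move=> k; have := H (lift ord0 k); rewrite tnthS !tb.
  move=> [H0 H1] k; have [j ->|->] := unliftP ord0 k.
    by rewrite tnthS -!tb; exact: H1.
  by move: H0; rewrite in_itv.
have mB : measurable
   ([set x | forall k, tnth a' k <= tnth x k <= tnth b' k] : set (d.-tuple RR)).
  rewrite (_ : [set x | _] = \bigcap_(k in [set: 'I_d])
      ((fun x : d.-tuple RR => tnth x k) @^-1` `[tnth a' k, tnth b' k])).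
    apply: fin_bigcap_measurable => // k _; rewrite -[X in measurable X]setTI.
    by apply: measurable_tnth.
  by apply/seteqP; split => x /= H k; have := H k; rewrite /= in_itv//=; exact.
rewrite product_measure1E//= IH; last by move=> k; rewrite !tb.
rewrite big_ord_recl EFinM; congr (_ * _)%E; last first.
  by congr EFin; apply: eq_bigr => k _; rewrite !tb.
rewrite lebesgue_measure_itv/= lte_fin; case: ltP => // ba.
by congr EFin; apply/esym/eqP; rewrite subr_eq0 eq_le ab ba.
Qed.

End lebesgue_tuple.

Section corners.
Context {R : realType} {d : nat}.
Implicit Types (x a b : d.-tuple R).

Definition corner := {ffun 'I_d -> bool}.

Implicit Types (c : corner).

Definition cube : set (d.-tuple R) :=
  [set x | forall k, 0 <= tnth x k <= 1].

Definition cornerLe c x : set (d.-tuple R) :=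
  [set s | cube s /\
    forall k, if c k then tnth x k <= tnth s k else tnth s k <= tnth x k].

Definition cornerECDF (n : nat) (X : 'I_n -> d.-tuple R) c x : R :=
  n%:R^-1 * \sum_(i < n) \1_(cornerLe c x) (X i).

Definition cornerCDF c x : R :=
  \prod_(k < d) (if c k then 1 - tnth x k else tnth x k).

Definition omega2 (n : nat) (X : 'I_n -> d.-tuple R) c : R :=
  \int[lebesgue_tuple d]_(x in cube) (cornerECDF X c x - cornerCDF c x) ^+ 2.

Definition cornerAvg (f : corner -> R) : R := (2 ^+ d)^-1 * \sum_c f c.

Definition omega2Avg (n : nat) (X : 'I_n -> d.-tuple R) : R :=
  cornerAvg (omega2 X).

Definition reflect_corner c (k : 'I_d) (t : R) : R :=
  if c k then 1 - t else t.

Definition pairFactor c a b : R :=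
  \prod_(k < d) (1 - Num.max (reflect_corner c k (tnth a k))
                             (reflect_corner c k (tnth b k))).

Definition crossFactor c a : R :=
  \prod_(k < d) ((1 - reflect_corner c k (tnth a k) ^+ 2) / 2).

Definition pairFactorAvg a b : R := cornerAvg (fun c => pairFactor c a b).

Definition crossFactorAvg a : R := cornerAvg (fun c => crossFactor c a).

End corners.

(* Main.v *)
(* In the coordinates reflected according to the corner c, the membership
   X_i \in cornerLe c x reads X_i <= x coordinatewise, and F^c(x) is the product
   of the coordinates of x. After expanding the square, every term is therefore
   a product over k of functions 1_[l_k, 1](u) u^e of the k-th reflected
   coordinate, with e = 0, 1, 2, and by Tonelli its integral over the cube is
   the product of the numbers (1 - l_k^(e+1)) / (e+1). *)
Require Import Defs.
From HB Require Import structures.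
From mathcomp Require Import all_boot all_order all_algebra.
From mathcomp Require Import all_classical all_reals all_analysis.
From mathcomp Require Import measurable_realfun ring lra.

Set Implicit Arguments.
Unset Strict Implicit.
Unset Printing Implicit Defensive.

Import Order.TTheory GRing.Theory Num.Theory.
Import numFieldNormedType.Exports.

Local Open Scope classical_set_scope.
Local Open Scope ring_scope.

(** * Linearity of the integral for integrable real functions *)

Section has_Rintegral.
Context d (T : measurableType d) (R : realType) (mu : {measure set T -> \bar R}).
Implicit Types (f g : T -> R) (v w : R).

(** Linearity of the real integral requires integrability of each term; carrying it together with
    the value lets both pass through sums and scalings at once. *)
Definition has_Rintegral f v :=
  mu.-integrable setT (EFin \o f) /\ \int[mu]_x f x = v.

Lemma has_RintegralD f g v w : has_Rintegral f v -> has_Rintegral g w ->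
  has_Rintegral (fun x => f x + g x) (v + w).
Proof.
move=> [fi <-] [gi <-]; split; last by rewrite RintegralD.
by apply: eq_integrable (integrableD measurableT fi gi).
Qed.

Lemma has_RintegralZ a f v : has_Rintegral f v ->
  has_Rintegral (fun x => a * f x) (a * v).
Proof.
move=> [fi <-]; split; last by rewrite RintegralZl.
by apply: eq_integrable (integrableZl measurableT a fi).
Qed.

Lemma has_Rintegral_sum n (f : 'I_n -> T -> R) (v : 'I_n -> R) :
  (forall i, has_Rintegral (f i) (v i)) ->
  has_Rintegral (fun x => \sum_i f i x) (\sum_i v i).
Proof.
elim: n f v => [|n IH] f v fv.
  rewrite big_ord0; under eq_fun do rewrite big_ord0.
  split; first exact: integrable0.
  by rewrite /Rintegral integral0.
rewrite big_ord_recl; under eq_fun do rewrite big_ord_recl.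
by apply: has_RintegralD => //; apply: IH.
Qed.

Lemma ge0_has_Rintegral f v : measurable_fun setT f -> (forall x, 0 <= f x) ->
  (\int[mu]_x (f x)%:E = v%:E)%E -> has_Rintegral f v.
Proof.
move=> mf f0 fv; split; last by rewrite /Rintegral fv.
apply/integrableP; split; first exact/measurable_EFinP.
under eq_integral do rewrite /= ger0_norm//.
by rewrite fv ltry.
Qed.

End has_Rintegral.

(** * Integration of polynomials on an interval and Tonelli's theorem on tuples *)

Section lebesgue_tuple_integral.
Context {R : realType}.
Local Notation RR := (measurableTypeR R).

Lemma integral_indic_mul (A : set RR) (f : RR -> R) :
  (\int[@lebesgue_measure R]_t (\1_A t * f t)%:E
   = \int[@lebesgue_measure R]_(t in A) (f t)%:E)%E.
Proof.
rewrite [RHS]integral_mkcond; apply: eq_integral => t _.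
by rewrite patchE indicE; case: (t \in A); rewrite ?mul1r ?mul0r.
Qed.

Lemma integral_deriv_horner (p : {poly R}) (a b : R) : a <= b ->
  (\int[@lebesgue_measure R]_(x in `[a, b]) (p^`().[x])%:E
   = (p.[b] - p.[a])%:E)%E.
Proof.
have cp (q : {poly R}) : continuous (horner q) by exact: continuous_horner.
(* [continuous_FTC2] needs [a < b], so the one-point interval is treated apart; it occurs when a
   threshold equals 1. *)
rewrite le_eqVlt => /predU1P[<-|ab].
  by rewrite set_itv1 integral_set1 subrr.
rewrite (@continuous_FTC2 _ _ (horner p))//.
- by apply: continuous_subspaceT; exact: cp.
- split.
  + by move=> x _; exact: derivable_horner.
  + by apply: cvg_at_right_filter; exact: cp.
  + by apply: cvg_at_left_filter; exact: cp.
- by move=> x _; rewrite derivE.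
Qed.

Lemma measurable_prod_tnth d (f : 'I_d -> RR -> R) :
  (forall k, measurable_fun setT (f k)) ->
  measurable_fun setT (fun x : d.-tuple RR => \prod_k f k (tnth x k)).
Proof.
move=> mf; apply: measurable_prod => k _.
exact: (measurableT_comp (mf k) (measurable_tnth k)).
Qed.

(** By induction on [d]: the measure is a pushforward along [tcons], so a change of variables
    followed by Tonelli splits off the first coordinate. For [d = 0] it is a Dirac mass and the
    product is empty. *)
Lemma integral_lebesgue_tuple_prod d (f : 'I_d -> RR -> R) (v : 'I_d -> R) :
  (forall k, measurable_fun setT (f k)) -> (forall k t, 0 <= f k t) ->
  (forall k, \int[@lebesgue_measure R]_t (f k t)%:E = (v k)%:E)%E ->
  (\int[lebesgue_tuple d]_x (\prod_k f k (tnth x k))%:E = (\prod_k v k)%:E)%E.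
Proof.
elim: d f v => [|d IH] f v mf f0 fv.
  by under eq_integral do rewrite big_ord0;
    rewrite big_ord0 integral_dirac// diracT mul1e.
pose h (k : 'I_d) := f (lift ord0 k).
pose g := fun x : d.-tuple RR => \prod_k h k (tnth x k).
have mg : measurable_fun setT g by apply: measurable_prod_tnth => k; exact: mf.
have g0 x : 0 <= g x by apply: prodr_ge0 => k _; exact: f0.
have IHg : (\int[lebesgue_tuple d]_x (g x)%:E
    = (\prod_k v (lift ord0 k))%:E)%E.
  by apply: IH => k; [exact: mf|exact: f0|exact: fv].
have mF : measurable_fun setT
    (fun x : d.+1.-tuple RR => (\prod_k f k (tnth x k))%:E).
  by apply/measurable_EFinP; exact: measurable_prod_tnth.
have F0 (x : d.+1.-tuple RR) : (0 <= (\prod_k f k (tnth x k))%:E)%E.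
  by rewrite lee_fin prodr_ge0.
have -> := ge0_integral_pushforward (@measurable_tcons R d)
  (@lebesgue_measure R \x lebesgue_tuple d)%E measurableT mF
  (in1W F0).
rewrite preimage_setT fubini_tonelli1//=; last first.
  by apply: measurableT_comp => //; exact: measurable_tcons.
under eq_integral => t _.
  rewrite /fubini_F/=.
  under eq_integral => x _.
    rewrite big_ord_recl /tcons/= tnth0 EFinM.
    under eq_bigr do rewrite tnthS.
    over.
  rewrite ge0_integralZl_EFin//; last 2 first.
    by move=> x _; rewrite lee_fin; exact: g0.
    exact/measurable_EFinP.
  rewrite -/(g _) IHg muleC.
  over.
rewrite ge0_integralZl_EFin//.
- by rewrite fv muleC -EFinM big_ord_recl.
- by move=> t _; rewrite lee_fin.
- exact/measurable_EFinP.
(* The constant pulled out must be nonnegative: each [v k] is the integral of a nonnegative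
   function. *)
- apply: prodr_ge0 => k _; rewrite -lee_fin -fv.
  by apply: integral_ge0 => t _; rewrite lee_fin.
Qed.

End lebesgue_tuple_integral.

(** * Products of truncated powers in reflected coordinates *)

Section corner_integral.
Context {R : realType} {d : nat}.
Local Notation RR := (measurableTypeR R).
Implicit Types (c : @corner d) (l : 'I_d -> R) (x a b : d.-tuple R).

(** For [0 <= l] the cut at 1 confines the support to [[0, 1]], so products of these factors can be
    integrated over the whole space instead of the cube. *)
Definition upperPow (l : R) (e : nat) (t : R) : R :=
  \1_(`[l, 1]%classic : set R) t * t ^+ e.

Lemma upperPow_ge0 (l : R) e t : 0 <= l -> 0 <= upperPow l e t.
Proof.
move=> l0; rewrite /upperPow indicE mem_setE in_itv/=.
have [/andP[lt _]|] := boolP (l <= t <= 1); last by rewrite mul0r.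
by rewrite mul1r exprn_ge0// (le_trans l0).
Qed.

Lemma measurable_reflect_corner c k :
  measurable_fun setT (reflect_corner c k : RR -> R).
Proof.
rewrite /reflect_corner; case: (c k) => //.
exact: measurable_funB.
Qed.

Lemma measurable_upperPow_reflect c k (l : R) e :
  measurable_fun setT (fun t : RR => upperPow l e (reflect_corner c k t)).
Proof.
have mr := measurable_reflect_corner c k.
apply: measurable_funM; last exact: measurable_funX.
by apply: measurableT_comp mr; exact: measurable_indic.
Qed.

Lemma integral_upperPow_reflect c k (l : R) e : 0 <= l <= 1 ->
  (\int[@lebesgue_measure R]_t (upperPow l e (reflect_corner c k t))%:E
   = ((1 - l ^+ e.+1) / e.+1%:R)%:E)%E.
Proof.
move=> /andP[l0 l1]; rewrite /upperPow /reflect_corner.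
have e0 : e.+1%:R != 0 :> R by rewrite pnatr_eq0.
case: (c k).
(* An antiderivative of [(1 - t) ^+ e]; the condition [l <= 1 - t <= 1] becomes
   [0 <= t <= 1 - l]. *)
- pose p : {poly R} := (- e.+1%:R^-1) *: (1 - 'X) ^+ e.+1.
  transitivity (\int[@lebesgue_measure R]_(t in `[0%R, (1 - l)%R])
    (p^`().[t])%:E)%E.
    rewrite -(integral_indic_mul _ (horner p^`())).
    apply: eq_integral => t _; congr EFin.
    rewrite !indicE !mem_setE !in_itv/=; congr (_%:R * _).
      by congr nat_of_bool; lra.
    rewrite derivZ deriv_exp derivB derivX -polyC1 derivC !(hornerMn, hornerE)/=.
    by field.
  rewrite integral_deriv_horner; last by rewrite subr_ge0.
  by rewrite /p !hornerE/= subKr subr0 expr1n; congr EFin; field.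
- pose p : {poly R} := e.+1%:R^-1 *: 'X^(e.+1).
  transitivity (\int[@lebesgue_measure R]_(t in `[l, 1%R]) (p^`().[t])%:E)%E.
    rewrite -(integral_indic_mul _ (horner p^`())).
    apply: eq_integral => t _; congr EFin.
    rewrite derivZ derivXn !(hornerMn, hornerE)/=.
    by field.
  rewrite integral_deriv_horner//.
  by rewrite /p !hornerE/= expr1n; congr EFin; field.
Qed.

(* [l] lives in reflected coordinates. On the cube, [e = 0] gives indicators of
   corner boxes and products of them, [e = 1] their products with [cornerCDF],
   and [e = 2] with [l = 0] the square of [cornerCDF]. *)
Definition cornerPow c l e x : R :=
  \prod_k upperPow (l k) e (reflect_corner c k (tnth x k)).

Lemma has_Rintegral_cornerPow c l e : (forall k, 0 <= l k <= 1) ->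
  has_Rintegral (lebesgue_tuple d) (cornerPow c l e)
    (\prod_k ((1 - l k ^+ e.+1) / e.+1%:R)).
Proof.
move=> l01; have l0 k : 0 <= l k by case/andP: (l01 k).
have mu k := measurable_upperPow_reflect c k (l k) e.
apply: ge0_has_Rintegral.
- exact: (measurable_prod_tnth mu).
- by move=> x; apply: prodr_ge0 => k _; exact: upperPow_ge0.
- apply: (integral_lebesgue_tuple_prod mu) => k; last first.
    exact: integral_upperPow_reflect.
  by move=> t; exact: upperPow_ge0.
Qed.

Lemma reflect_corner01 c k (t : R) :
  (0 <= reflect_corner c k t <= 1) = (0 <= t <= 1).
Proof. by rewrite /reflect_corner; case: (c k) => //; lra. Qed.

(** Reflection preserves [[0, 1]] and its complement, so a coordinate outside it makes its own
    factor zero. *)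
Lemma cornerPow_out c l e x :
  (forall k, 0 <= l k) -> ~ cube x -> cornerPow c l e x = 0.
Proof.
move=> l0 /existsNP[k /negP xk]; apply/eqP/prodf_eq0; exists k => //.
rewrite /upperPow indicE mem_setE in_itv/=.
rewrite -(reflect_corner01 c k) in xk.
case: (boolP (_ <= _ <= 1)) => [/andP[lr r1]|_]; last by rewrite mul0r.
by move: xk; rewrite r1 (le_trans (l0 k) lr).
Qed.

Definition cornerReflect c a (k : 'I_d) : R := reflect_corner c k (tnth a k).

(** Reflection reverses the order exactly where [c k] is true, which merges the two cases of
    [cornerLe]; the upper bound 1 is automatic on the cube. *)
Lemma indic_cornerLe c a x : cube a -> cube x ->
  \1_(cornerLe c x) a = cornerPow c (cornerReflect c a) 0 x.
Proof.
move=> a01 x01; rewrite /cornerPow /upperPow.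
under eq_bigr do rewrite expr0 mulr1 indicE mem_setE in_itv/=.
rewrite indicE; case: (boolP (_ \in _)) => [|/negP].
  rewrite in_setE => -[_ H]; apply/esym/big1 => k _.
  move: (H k) (a01 k) (x01 k); rewrite /cornerReflect /reflect_corner.
  by case: (c k) => h ha hx; rewrite (_ : _ && _ = true) //; lra.
rewrite in_setE => H; apply/esym/eqP/prodf_eq0.
have /existsNP[k Hk] : ~ (forall k,
  if c k then tnth x k <= tnth a k else tnth a k <= tnth x k).
  by move=> h; apply: H.
exists k => //; move: Hk (a01 k) (x01 k); rewrite /cornerReflect /reflect_corner.
case: (c k) => /negP h ha hx; rewrite pnatr_eq0 eqb0; lra.
Qed.

(** Intersecting [[l k, 1]] with [[l' k, 1]] raises the threshold to the maximum, the source of the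
    maximum in [pairFactor]. *)
Lemma cornerPow_max c l l' x :
  cornerPow c (fun k => Num.max (l k) (l' k)) 0 x
  = cornerPow c l 0 x * cornerPow c l' 0 x.
Proof.
rewrite /cornerPow -big_split/=; apply: eq_bigr => k _.
rewrite /upperPow !expr0 !mulr1 !indicE !mem_setE !in_itv/= -natrM mulnb.
rewrite ge_max; congr (nat_of_bool _)%:R.
by case: (_ <= 1); rewrite ?andbT ?andbF.
Qed.

Lemma cornerCDFE c x : cornerCDF c x = \prod_k cornerReflect c x k.
Proof. by []. Qed.

Lemma cornerPow_CDF c l e x :
  cornerPow c l e x = cornerPow c l 0 x * cornerCDF c x ^+ e.
Proof.
rewrite cornerCDFE -prodrXl /cornerPow -big_split/=; apply: eq_bigr => k _.
by rewrite /upperPow expr0 mulr1.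
Qed.

Lemma cornerPow00 c x : cube x -> cornerPow c (fun=> 0) 0 x = 1.
Proof.
move=> x01; apply: big1 => k _.
by rewrite /upperPow expr0 mulr1 indicE mem_setE in_itv/= reflect_corner01 x01.
Qed.

Lemma omega2_expansion n (X : 'I_n -> d.-tuple R) c :
  (forall i, cube (X i)) ->
  ((fun x => (cornerECDF X c x - cornerCDF c x) ^+ 2) \_ cube) =
  (fun x => (n%:R ^+ 2)^-1 * (\sum_(i < n) \sum_(j < n) cornerPow c
       (fun k => Num.max (cornerReflect c (X i) k) (cornerReflect c (X j) k))
       0 x)
    + (- (2 / n%:R)) * (\sum_(i < n) cornerPow c (cornerReflect c (X i)) 1 x)
    + cornerPow c (fun=> 0) 2 x).
Proof.
move=> hX; have r0 i k : 0 <= cornerReflect c (X i) k.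
  by move: (hX i k); rewrite -(reflect_corner01 c k) => /andP[].
apply/funext => x; rewrite patchE; case: ifPn => [/set_mem xc|/negP].
  (* On the cube the right-hand side is folded back: the double sum becomes the square of the sum of
     indicators, and the powers of [cornerCDF] factor out. *)
  under eq_bigr do under eq_bigr do rewrite cornerPow_max -!indic_cornerLe//.
  under [in X in _ = _ + _ * X + _]eq_bigr do
    rewrite cornerPow_CDF -indic_cornerLe// expr1.
  under eq_bigr do rewrite -mulr_sumr.
  rewrite -mulr_suml -[in X in _ + X + _]mulr_suml cornerPow_CDF.
  by rewrite cornerPow00// /cornerECDF -exprVn; ring.
rewrite in_setE => xc.
rewrite big1 => [|i _]; last first.
  by apply: big1 => j _; apply: cornerPow_out => // k; rewrite le_max r0.
rewrite big1 => [|i _]; last exact: cornerPow_out.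
by rewrite cornerPow_out// !mulr0 !addr0.
Qed.

Lemma omega2E n (X : 'I_n -> d.-tuple R) c : (forall i, cube (X i)) ->
  omega2 X c =
    (n%:R ^+ 2)^-1 * (\sum_(i < n) \sum_(j < n) pairFactor c (X i) (X j))
    + (- (2 / n%:R)) * (\sum_(i < n) crossFactor c (X i)) + (1 / 3) ^+ d.
Proof.
move=> hX; have r01 i k : 0 <= cornerReflect c (X i) k <= 1.
  by rewrite reflect_corner01; exact: hX.
rewrite /omega2 Rintegral_mkcond omega2_expansion//.
(* The stronger claim with integrability follows the shape of the expansion, term by term. *)
apply: (proj2 (_ : has_Rintegral _ _ _)).
apply: has_RintegralD; first apply: has_RintegralD.
- apply: has_RintegralZ; apply: has_Rintegral_sum => i.
  apply: has_Rintegral_sum => j.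
  rewrite (_ : pairFactor _ _ _ = \prod_k ((1 - (Num.max
    (cornerReflect c (X i) k) (cornerReflect c (X j) k)) ^+ 1) / 1%:R)).
    apply: has_Rintegral_cornerPow => k.
    move: (r01 i k) (r01 j k) => /andP[? ?] /andP[? ?].
    by rewrite le_max ge_max; apply/andP; split; [apply/orP; left|apply/andP].
  by apply: eq_bigr => k _; rewrite divr1.
- by apply: has_RintegralZ; apply: has_Rintegral_sum => i;
    exact: has_Rintegral_cornerPow.
(* Each coordinate contributes the integral of [u ^+ 2] over [[0, 1]]. *)
- rewrite (_ : _ ^+ d = \prod_(k < d) ((1 - 0 ^+ 3) / 3%:R)).
    by apply: has_Rintegral_cornerPow => k; rewrite lexx ler01.
  by rewrite prodr_const card_ord expr0n subr0.
Qed.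

End corner_integral.

Theorem theorem3p2 (R : realType) (d : nat) (hd : (1 <= d)%N)
    (n : nat) (hn : (1 <= n)%N)
    (X : 'I_n -> d.-tuple R) (hX : forall i, cube (X i)) :
  omega2Avg X =
    (n%:R ^+ 2)^-1 * \sum_(i < n) \sum_(j < n) pairFactorAvg (X i) (X j)
    - 2 / n%:R * \sum_(i < n) crossFactorAvg (X i)
    + (1 / 3) ^+ d.
Proof.
have avg_const (v : R) : @cornerAvg R d (fun=> v) = v.
  rewrite /cornerAvg sumr_const card_ffun card_bool card_ord -[v *+ _]mulr_natl.
  by rewrite natrX mulKf// expf_neq0// pnatr_eq0.
have avg_sum (F : corner -> 'I_n -> R) :
    \sum_i cornerAvg (fun c => F c i) = cornerAvg (fun c => \sum_i F c i).
  by rewrite /cornerAvg -mulr_sumr exchange_big.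
(* Once the constant is also written as an average, both sides are linear in corner averages and
   [omega2E] applies corner by corner. *)
rewrite -[in RHS](avg_const ((1 / 3) ^+ d)) /pairFactorAvg /crossFactorAvg.
under [in RHS]eq_bigr do rewrite avg_sum.
rewrite !avg_sum /omega2Avg /cornerAvg.
under [in LHS]eq_bigr do rewrite omega2E//.
rewrite !big_split/= -!mulr_sumr.
ring.
Qed.
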